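(* Let $0<\alpha<1$, $\nu>0$, $T>1$, let $G\subset\mathbb{R}^n$ be a bounded domain with smooth boundary $\partial G$, and put $\Omega=G\times(1,T]$. Let $F$ be continuous on $\overline\Omega$ and let $\varphi,\overline{\varphi}$ be continuous on $\bar G$. Suppose $u$ and $\overline{u}$ are solutions of $$D_{*,t}^{\alpha}v(x,t)=\nu\Delta_x v(x,t)+F(x,t),\quad (x,t)\in\Omega,$$ both with the homogeneous boundary condition $v(x,t)=0$ for $x\in\partial G$, $1\le t\le T$, and with initial data $u(x,1)=\varphi(x)$ and $\overline{u}(x,1)=\overline{\varphi}(x)$, $x\in\bar G$, respectively. If $\max_{x\in\bar G}|\varphi(x)-\overline{\varphi}(x)|\le\delta$, then $$|u(x,t)-\overline{u}(x,t)|\le\delta\quad\text{for all }(x,t)\in\overline\Omega .$$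
   Context: $\Delta_x v=\sum_{j=1}^n\partial^2v/\partial x_j^2$, $\overline\Omega=\bar G\times[1,T]$, and $D_{*,t}^{\alpha}$ is the Hadamard-type fractional derivative in $t$ with base point $1$: $$D_{*,t}^{\alpha}v(x,t)=\frac{1}{\Gamma(1-\alpha)}\int_1^t\left(\log\frac{t}{s}\right)^{-\alpha}\frac{\partial v}{\partial s}(x,s)\,ds .$$ Solutions are classical: $v\in C(\overline\Omega)$ is real-valued, $v(\cdot,t)\in C^2(G)$ for each $t\in(1,T]$, $v(x,\cdot)\in W^1_2([1,T])$ (Sobolev space) for each $x\in G$, the integral defining $D_{*,t}^{\alpha}v(x,t)$ converges absolutely at every $(x,t)\in\Omega$, and the equation holds at every point of $\Omega$. *)

(* Defs.v *)
From HB Require Import structures.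
From mathcomp Require Import all_boot all_order all_algebra.
From mathcomp Require Import all_classical all_reals all_analysis.

Set Implicit Arguments.
Unset Strict Implicit.
Unset Printing Implicit Defensive.

Import Order.TTheory GRing.Theory Num.Theory.
Import numFieldNormedType.Exports.

Local Open Scope classical_set_scope.
Local Open Scope ring_scope.

Section partial_derivatives.
Context {R : realType} {n : nat}.
Implicit Types (f : 'rV[R]_n -> R) (U : set 'rV[R]_n).

Definition basis_vec (j : 'I_n) : 'rV[R]_n := delta_mx 0 j.

Definition partial (j : 'I_n) f : 'rV[R]_n -> R := 'D_(basis_vec j) f.

(* [partials [:: j1; ..; jk] f] is d_j1 (.. (d_jk f)). *)
Definition partials (s : seq 'I_n) f : 'rV[R]_n -> R := foldr partial f s.

(* Meant for open [U]. Derivability is required explicitly because ['D_v f] is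
   a total function, with a default value where the limit does not exist. *)
Definition Ck_on (k : nat) U f : Prop :=
  (forall (s : seq 'I_n) (j : 'I_n), (size s < k)%N ->
     forall x, U x -> derivable (partials s f) x (basis_vec j)) /\
  (forall s : seq 'I_n, (size s <= k)%N ->
     forall x, U x -> {for x, continuous (partials s f)}).

Definition smooth_on U f : Prop := forall k, Ck_on k U f.

Definition laplacian f (x : 'rV[R]_n) : R :=
  \sum_(j < n) partial j (partial j f) x.

End partial_derivatives.

Section domains.
Context {R : realType} {n : nat}.
Implicit Types G : set 'rV[R]_n.

Definition boundary G : set 'rV[R]_n := closure G `\` interior G.

Definition bounded_domain G : Prop :=
  [/\ open G, connected G, G !=set0 & bounded_set G].

(* Near each boundary point, [G] is one side of a smooth hypersurface, given
   by a smooth defining function without critical points. *)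
Definition smooth_boundary G : Prop :=
  forall x0, boundary G x0 ->
  exists (U : set 'rV[R]_n) (rho : 'rV[R]_n -> R),
    [/\ open U, U x0, smooth_on U rho,
        (forall x, U x -> exists j, partial j rho x != 0) &
        (forall x, U x -> (G x <-> rho x < 0))].

End domains.

Section sobolev.
Context {R : realType}.
Let mu := @lebesgue_measure R.

Definition L2 (a b : R) (f : R -> R) : Prop :=
  f \_ `]a, b[%classic \in Lfun mu 2%:E.

Definition test_function (a b : R) (p : R -> R) : Prop :=
  [/\ (forall k s, derivable (derive1n k p) s 1),
      compact (closure [set s | p s != 0]) &
      closure [set s | p s != 0] `<=` `]a, b[%classic].

(* For [f] and [g] in [L2 a b], as in [W12] below: both integrals exist. *)
Definition weak_derivative (a b : R) (f g : R -> R) : Prop :=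
  forall p, test_function a b p ->
    \int[mu]_(s in `]a, b[) (f s * derive1 p s) =
    - \int[mu]_(s in `]a, b[) (g s * p s).

Definition W12 (a b : R) (f : R -> R) : Prop :=
  L2 a b f /\ exists g, L2 a b g /\ weak_derivative a b f g.

End sobolev.

Section hadamard.
Context {R : realType}.
Let mu := @lebesgue_measure R.

Definition Gamma (z : R) : R :=
  \int[mu]_(x in `]0, +oo[) (x `^ (z - 1) * expR (- x)).

(* For [f] continuous and in [W12 1 T], [derive1 f] is defined almost everywhere
   on ]1, T[ and is a Borel representative of the weak derivative of [f]. *)
Definition hadamard_integrand (alpha : R) (f : R -> R) (t s : R) : R :=
  ln (t / s) `^ (- alpha) * derive1 f s.

Definition hadamard_converges (alpha : R) (f : R -> R) (t : R) : Prop :=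
  mu.-integrable `]1, t[ (EFin \o hadamard_integrand alpha f t).

Definition hadamard (alpha : R) (f : R -> R) (t : R) : R :=
  (Gamma (1 - alpha))^-1 *
  \int[mu]_(s in `]1, t[) hadamard_integrand alpha f t s.

End hadamard.

(* Functions on closure G x [1, T] are represented by total functions of
   (x, t); nothing depends on their values elsewhere. *)
Record classical_solution {R : realType} {n : nat} (alpha nu T : R)
    (G : set 'rV[R]_n) (F v : 'rV[R]_n -> R -> R) : Prop := {
  solution_continuous :
    {within closure G `*` `[1, T]%classic, continuous (fun z => v z.1 z.2)} ;
  solution_C2 :
    forall t, 1 < t <= T -> Ck_on 2 G (fun x => v x t) ;
  solution_W12 :
    forall x, G x -> W12 1 T (v x) ;
  solution_converges :
    forall x t, G x -> 1 < t <= T -> hadamard_converges alpha (v x) t ;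
  solution_equation :
    forall x t, G x -> 1 < t <= T ->
      hadamard alpha (v x) t = nu * laplacian (fun y => v y t) x + F x t
}.

(* Main.v *)
Require Import Defs.
From HB Require Import structures.
From mathcomp Require Import all_boot all_order all_algebra.
From mathcomp Require Import all_classical all_reals all_analysis.
From mathcomp Require Import measurable_realfun ring lra.

Set Implicit Arguments.
Unset Strict Implicit.
Unset Printing Implicit Defensive.

Import Order.TTheory GRing.Theory Num.Theory.
Import numFieldNormedType.Exports.

Local Open Scope classical_set_scope.
Local Open Scope ring_scope.

(** The estimate is a maximum principle for the difference w of the two
    solutions, applied to w and to - w.  Suppose that w exceeds delta
    somewhere on the compact cylinder closure G x [1, T], and let (x0, t0) be
    a maximum point.  The boundary and initial data exclude the boundary of G
    and the time 1, so x0 lies in the open set G and t0 > 1.  In space,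
    the maximum gives Laplacian w (x0, t0) <= 0 ([laplacian_sub_le0]).  In
    time, it makes the fractional derivative strictly positive
    ([hadamard_sub_gt0]), because of the extremum inequality
      D w (x0, t0) >= (log t0)^(-alpha) (w (x0, t0) - w (x0, 1))
                      / Gamma (1 - alpha) > 0.
    As w solves the homogeneous equation D w = nu Laplacian w, this is absurd.

    The extremum inequality would be one integration by parts for smooth w:
    with k (s) = (log (t0 / s))^(-alpha), which increases in s, and
    z := w (x0, t0) - w (x0, .) >= 0, the integral of k w' is
    k (1) z (1) plus the integral of k' z.  Here k is singular at t0 and w' is
    only integrable, so [monotone_kernel_ge] instead shows that
      r |-> (integral of k w' over [1, r]) + k (r) z (r)
    is nondecreasing, because it drops over a short interval by at most the
    product of the increments there of k and of the integral of |w'|, which is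
    of second order.  Then r tends to t0, and absolute convergence of k w'
    disposes of the boundary term k (r) z (r).

    This needs w to be the integral of its pointwise derivative, whereas
    membership in W^1_2 only gives a weak derivative.  [W12_FTC] makes the
    link.  Testing against smooth functions that increase to the indicator of
    ]c, d[ identifies f d - f c with the integral of the weak derivative over
    ]c, d[ (dominated convergence on one side, concentration of the derivative
    of the test functions at c and d on the other); Lebesgue differentiation
    then identifies the weak derivative with the pointwise one almost
    everywhere.  The test functions are exp (- 1 / y), extended by 0 to
    y <= 0, composed with parabolas y vanishing at c and d.  Finally
    [Gamma_gt0] is needed because Gamma is given by an integral whose value
    would be 0 if it diverged. *)

(** * Smooth bump functions *)

Section flat.
Context {R : realType}.
Implicit Types (P Q : {poly R}) (s : R).

Lemma cvgy_exprn_expRN n : z ^+ n * expR (- z) @[z --> +oo%R] --> (0 : R).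
Proof.
have h : (n.+1)`!%:R * z^-1 @[z --> +oo%R] --> (0 : R).
  rewrite -[X in _ --> X](mulr0 (n.+1)`!%:R).
  apply: cvgMl_tmp; apply/gtr0_cvgV0; last exact: cvg_id.
  exact: nbhs_pinfty_gt.
apply: (@squeeze_cvgr _ _ _ _ (cst 0) (fun z => (n.+1)`!%:R * z^-1)) h => //; last exact: cvg_cst.
near=> z.
have z0 : 0 < z by near: z; exact: nbhs_pinfty_gt.
rewrite mulr_ge0 ?expR_ge0 ?exprn_ge0 ?(ltW z0)//=.
have := expR_ge1Dxn n (ltW z0).
set F : R := (n.+1)`!%:R.
have F0 : 0 < F by rewrite ltr0n fact_gt0.
move=> H.
rewrite expRN ler_pdivrMr ?expR_gt0// mulrAC ler_pdivlMr// -exprSr -ler_pdivrMl//.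
by rewrite mulrC (le_trans _ H)// lerDr.
Unshelve. all: by end_near. Qed.

Lemma cvgy_horner_expRN P : P.[z] * expR (- z) @[z --> +oo%R] --> (0 : R).
Proof.
rewrite (_ : (fun z => _) = fun z => \sum_(i < size P) P`_i * (z ^+ i * expR (- z))); last first.
  by apply/funext => z; rewrite horner_coef mulr_suml; apply: eq_bigr => i _; rewrite mulrA.
have -> : nbhs (0 : R) = nbhs (\sum_(i < size P) P`_i * (0 : R)).
  by rewrite big1// => i _; rewrite mulr0.
by apply: cvg_big => [|i _]; [exact: add_continuous|apply: cvgMl_tmp; exact: cvgy_exprn_expRN].
Qed.

Lemma is_derive_horner P s : is_derive s 1 (horner P) (P^`().[s]).
Proof.
apply: DeriveDef; first exact: derivable_horner.
by rewrite -derive1E derivE.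
Qed.

(** A polynomial factor in 1 / x makes the family closed under derivation. *)
Definition flat P (x : R) : R := if 0 < x then P.[x^-1] * expR (- x^-1) else 0.

Lemma flat_le0 P x : x <= 0 -> flat P x = 0.
Proof. by rewrite /flat leNgt => /negbTE ->. Qed.

(** Exponential decay beats the polynomial growth in 1 / h. *)
Lemma cvgr_flat0 P : flat P h @[h --> 0^'] --> (0 : R).
Proof.
apply: (@cvg_at_right_left_dnbhs _ R^o).
  have : (fun z => P.[z] * expR (- z)) \o (@GRing.inv R) @ 0^'+ --> (0 : R).
    apply: cvg_comp (cvgy_horner_expRN P).
    apply/gtr0_cvgV0; first by near=> x; rewrite invr_gt0; near: x; exact: nbhs_right_gt.
    rewrite (_ : unstable.inv_fun _ = id); last by apply/funext => x /=; rewrite /unstable.inv_fun invrK.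
    by apply: cvg_at_right_filter; exact: cvg_id.
  apply: cvg_trans; apply: near_eq_cvg; near=> x.
  by rewrite /flat ifT//; near: x; exact: nbhs_right_gt.
have : cst (0 : R) x @[x --> (0 : R)^'-] --> (0 : R) by exact: cvg_cst.
apply: cvg_trans; apply: near_eq_cvg; near=> x.
by rewrite flat_le0.
Unshelve. all: by end_near. Qed.

Lemma is_derive_flat P (x : R) :
  is_derive x 1 (flat P) (flat ('X ^+ 2 * (P - P^`())) x).
Proof.
have [x0|x0|->] := ltgtP x 0.
- have : is_derive x 1 (cst 0 : R -> R) 0 by exact: is_derive_cst.
  rewrite flat_le0 ?ltW//.
  apply: near_eq_is_derive.
  near=> y; rewrite flat_le0//; near: y.
  exact: lt_le_nbhsl x0.
- have x1 : x != 0 by rewrite gt_eqF.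
  have : is_derive x 1 (fun y => P.[y^-1] * expR (- y^-1)) (flat ('X ^+ 2 * (P - P^`())) x).
    have dV := @is_deriveV _ id x 1 1 x1 (is_derive_id x 1).
    have dE : is_derive x 1 (expR \o (fun y => - y^-1)) (expR (- x^-1) * (- (- x ^- 2 *: 1))).
      exact: (@is_derive1_comp _ _ _ _ _ _ (is_derive_expR _) (is_deriveN dV)).
    have dH : is_derive x 1 (horner P \o (fun y => y^-1)) (P^`().[x^-1] * (- x ^- 2 *: 1)).
      exact: (@is_derive1_comp _ _ _ _ _ _ (is_derive_horner _ _) dV).
    apply: is_derive_eq (is_deriveM dH dE) _.
    rewrite /flat x0 /= hornerM hornerXn hornerD hornerN /GRing.scale/= exprVn.
    by ring.
  apply: near_eq_is_derive.
  near=> y; rewrite /flat ifT//; near: y.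
  exact: lt_nbhsr.
- rewrite flat_le0//.
  (* at 0 the difference quotient of [flat P] is [flat ('X * P)] *)
  have H : h^-1 *: ((flat P \o shift 0) (h *: 1) - flat P 0) @[h --> 0^'] --> (0 : R).
    have := @cvgr_flat0 ('X * P).
    apply: cvg_trans; apply: near_eq_cvg; near=> h.
    have h0 : h != 0 by near: h; exact: nbhs_dnbhs_neq.
    rewrite /= addr0 (@flat_le0 _ 0)// subr0.
    rewrite /flat [h *: 1]mulr1 /GRing.scale /=; case: ifPn => h1; last by rewrite mulr0.
    by rewrite hornerM hornerX !mulrA.
  apply: DeriveDef; first by apply/cvg_ex; exists 0.
  exact: cvg_lim.
Unshelve. all: by end_near. Qed.
End flat.

Section bump.
Context {R : realType}.
Implicit Types (P q r : {poly R}) (f : R -> R) (c d s : R).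

(** Smoothness is proved by exhibiting a class of derivable functions that is
    stable under derivation; sums are there for the Leibniz rule, and [r]
    stays fixed. *)
Inductive flat_sum r : (R -> R) -> Prop :=
| flat_sum1 P q : flat_sum r (fun s => flat P r.[s] * q.[s])
| flat_sumD f g : flat_sum r f -> flat_sum r g -> flat_sum r (f \+ g).

Lemma is_derive_flat_horner P r s :
  is_derive s 1 (fun s => flat P r.[s]) (flat ('X ^+ 2 * (P - P^`())) r.[s] * r^`().[s]).
Proof.
exact: (@is_derive1_comp _ _ _ _ _ _ (is_derive_flat _ _) (is_derive_horner _ _)).
Qed.

Lemma flat_sum_derive r f : flat_sum r f ->
  (forall s, derivable f s 1) /\ flat_sum r (derive1 f).
Proof.
elim=> {f} [P q|f g _ [df f'] _ [dg g']].
  have H s : is_derive s 1 (fun s => flat P r.[s] * q.[s])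
      (flat P r.[s] * q^`().[s] +
       flat ('X ^+ 2 * (P - P^`())) r.[s] * (q * r^`()).[s]).
    apply: is_derive_eq (is_deriveM (is_derive_flat_horner P r s) (is_derive_horner q s)) _.
    by rewrite /GRing.scale/= hornerM; ring.
  split; first by move=> s; have [] := H s.
  have -> : derive1 (fun s => flat P r.[s] * q.[s]) =
      (fun s => flat P r.[s] * q^`().[s]) \+
       (fun s => flat ('X ^+ 2 * (P - P^`())) r.[s] * (q * r^`()).[s]).
    by apply/funext => s; rewrite derive1E; have [_ ->] := H s.
  by apply: flat_sumD; apply: flat_sum1.
split; first by move=> s; apply: derivableD.
have -> : derive1 (f \+ g) = derive1 f \+ derive1 g.
  by apply/funext => s; rewrite /= !derive1E; apply: deriveD.
exact: flat_sumD.
Qed.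

Lemma flat_sum_smooth r f : flat_sum r f ->
  forall k s, derivable (derive1n k f) s 1.
Proof.
move=> rf k; suff : flat_sum r (derive1n k f) by case/flat_sum_derive.
elim: k => [//|k IH]; rewrite derive1nS.
by case/flat_sum_derive : IH.
Qed.

(** The factor n + 1 makes the bumps [exp (- 1 / tent)] increase to the
    indicator of ]c, d[. *)
Definition tent c d (n : nat) : {poly R} := n.+1%:R%:P * ('X - c%:P) * (d%:P - 'X).

Lemma hornerE_tent c d n s : (tent c d n).[s] = n.+1%:R * ((s - c) * (d - s)).
Proof. by rewrite /tent !(hornerM, hornerC, hornerD, hornerN, hornerX) mulrA. Qed.

Lemma horner_deriv_tent c d n s : (tent c d n)^`().[s] = n.+1%:R * (c + d - 2 * s).
Proof. rewrite /tent !(derivM, derivC, derivD, derivN, derivX); rewrite !(hornerM, hornerC, hornerD, hornerN, hornerX); ring. Qed.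

Definition bump c d n s : R := flat 1 (tent c d n).[s].

Lemma tent_le0 c d n s : c < d -> ~~ (c < s < d) -> (tent c d n).[s] <= 0.
Proof.
move=> cd; rewrite hornerE_tent negb_and -!leNgt => h.
rewrite mulr_ge0_le0//.
case/orP: h => h; first by rewrite mulr_le0_ge0; lra.
by rewrite mulr_ge0_le0; lra.
Qed.

Lemma bump_out c d n s : c < d -> ~~ (c < s < d) -> bump c d n s = 0.
Proof. by move=> cd h; rewrite /bump flat_le0// tent_le0. Qed.

Lemma bump_in c d n s : c < s < d ->
  bump c d n s = expR (- (n.+1%:R * ((s - c) * (d - s)))^-1).
Proof.
move=> h; rewrite /bump /flat hornerE_tent ifT ?hornerC ?mul1r//.
by rewrite !mulr_gt0//; lra.
Qed.

Lemma bump_itv c d n s : 0 <= bump c d n s <= 1.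
Proof.
rewrite /bump /flat; case: ifP => h; last by rewrite lexx ler01.
by rewrite hornerC mul1r expR_ge0/= expR_le1 oppr_le0 invr_ge0 ltW.
Qed.

(** The derivative of [bump c d n], in closed form so that its sign on either
    side of the midpoint is visible. *)
Definition dbump c d n s : R := flat ('X ^+ 2) (tent c d n).[s] * (tent c d n)^`().[s].

Lemma is_derive_bump c d n s : is_derive s 1 (bump c d n) (dbump c d n s).
Proof.
apply: is_derive_eq (is_derive_flat_horner _ _ _) _.
by rewrite /dbump derivC subr0 mulr1.
Qed.

Lemma derive1_bump c d n : derive1 (bump c d n) = dbump c d n.
Proof. by apply/funext => s; rewrite derive1E; have [_ ->] := is_derive_bump c d n s. Qed.

Lemma bump_smooth c d n k s : derivable (derive1n k (bump c d n)) s 1.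
Proof.
apply: (@flat_sum_smooth (tent c d n)).
rewrite (_ : bump c d n = fun s => flat 1 (tent c d n).[s] * (1 : {poly R}).[s]).
  exact: flat_sum1.
by apply/funext => x; rewrite hornerC mulr1.
Qed.

Lemma continuous_bump c d n : continuous (bump c d n).
Proof.
move=> s; apply: differentiable_continuous; apply/derivable1_diffP. exact: (@bump_smooth c d n 0%N s).
Qed.

Lemma continuous_dbump c d n : continuous (dbump c d n).
Proof.
move=> s; apply: differentiable_continuous; apply/derivable1_diffP.
by rewrite -derive1_bump; exact: (@bump_smooth c d n 1%N s).
Qed.

Lemma bump_test a b c d n : a < c -> c < d -> d < b ->
  test_function a b (bump c d n).
Proof.
move=> ac cd db.
have S : closure [set s | bump c d n s != 0] `<=` `[c, d]%classic.
  rewrite closureE => s; apply; split; first exact: itv_closed.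
  move=> x /= h; rewrite in_itv/=; have [//|hx] := boolP (c < x < d); first by lra.
  by rewrite bump_out ?eqxx in h.
split; first by move=> k s; exact: bump_smooth.
- apply: (subclosed_compact _ (@segment_compact _ c d)) => //.
  exact: closed_closure.
- by apply: subset_trans S _ => x /=; rewrite !in_itv/=; lra.
Qed.

Lemma cvg_bump c d s : c < s < d -> bump c d n s @[n --> \oo] --> (1 : R).
Proof.
move=> h; rewrite (_ : (fun n => _) = expR \o (fun n => - (n.+1%:R^-1 * ((s - c) * (d - s))^-1))); last first.
  by apply/funext => n; rewrite bump_in//= invfM.
rewrite -[X in _ --> X](expR0 R) -[X in expR X]oppr0.
apply: continuous_cvg; first exact: continuous_expR.
apply: cvgN; rewrite -[X in _ --> X](mul0r ((s - c) * (d - s))^-1).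
apply: cvgMr_tmp; exact: cvg_harmonic.
Qed.

Lemma dbump_out c d n s : c < d -> ~~ (c < s < d) -> dbump c d n s = 0.
Proof. by move=> cd h; rewrite /dbump flat_le0 ?mul0r// tent_le0. Qed.

Lemma dbump_ge0 c d n s : s <= (c + d) / 2 -> 0 <= dbump c d n s.
Proof.
move=> h; rewrite /dbump horner_deriv_tent mulr_ge0//.
  by rewrite /flat; case: ifP => // h0; rewrite mulr_ge0 ?expR_ge0// hornerXn exprn_ge0// invr_ge0 ltW.
by rewrite mulr_ge0//; lra.
Qed.

Lemma dbump_le0 c d n s : (c + d) / 2 <= s -> dbump c d n s <= 0.
Proof.
move=> h; rewrite /dbump horner_deriv_tent mulr_ge0_le0//.
  by rewrite /flat; case: ifP => // h0; rewrite mulr_ge0 ?expR_ge0// hornerXn exprn_ge0// invr_ge0 ltW.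
by rewrite mulr_ge0_le0//; lra.
Qed.
End bump.

(** * From weak derivatives to the fundamental theorem of calculus *)

Section weak_derivative.
Context {R : realType}.
Notation mu := (@lebesgue_measure R).
Implicit Types (f g h p q : R -> R) (a b c d e u v s C : R).

Lemma Rintegral_subset (A B : set R) h : B `<=` A -> (forall s, A s -> ~ B s -> h s = 0) ->
  \int[mu]_(s in A) h s = \int[mu]_(s in B) h s.
Proof.
move=> BA h0; rewrite Rintegral_mkcond [RHS]Rintegral_mkcond.
apply: eq_Rintegral => s _; rewrite !patchE.
have [sA|sA] := boolP (s \in A); have [sB|sB] := boolP (s \in B) => //.
  by apply: h0; [exact: set_mem|move=> /mem_set; apply/negP].
by move: sA; rewrite mem_set//; apply: BA; exact: set_mem.
Qed.

Lemma Rintegral_cut h a m b : a <= m -> m <= b ->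
  mu.-integrable `[a, b] (EFin \o h) ->
  \int[mu]_(s in `[a, b]) h s = \int[mu]_(s in `[a, m]) h s + \int[mu]_(s in `[m, b]) h s.
Proof.
move=> am mb ih.
have := @Rintegral_itvB _ h (BLeft a) (BRight b) m ih.
rewrite !bnd_simp => /(_ am mb) H.
rewrite -(@Rintegral_itv_obnd_cbnd _ m); last first.
  by apply: integrableS ih => //; apply: subset_itvr; rewrite bnd_simp.
by rewrite -H addrC subrK.
Qed.

Lemma Rintegral_derive a b q q' : a <= b -> (forall s, is_derive s 1 q (q' s)) ->
  continuous q' -> \int[mu]_(s in `[a, b]) q' s = q b - q a.
Proof.
rewrite le_eqVlt => /predU1P[<- _ _|ab dq cq'].
  by rewrite set_itv1 Rintegral_set1 subrr.
have cq : continuous q.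
  move=> s; apply: differentiable_continuous; apply/derivable1_diffP.
  by have [] := dq s.
rewrite /Rintegral (@continuous_FTC2 _ _ q)//.
- exact: continuous_subspaceT.
- split.
  + by move=> s _; have [] := dq s.
  + by apply: cvg_at_right_filter; exact: cq.
  + by apply: cvg_at_left_filter; exact: cq.
- by move=> s _; rewrite derive1E; have [_ ->] := dq s.
Qed.

Lemma integrable_cont_mul a b f g : {within `[a, b], continuous f} -> continuous g ->
  mu.-integrable `[a, b] (EFin \o (fun s => f s * g s)).
Proof.
move=> cf cg; apply: continuous_compact_integrable; first exact: segment_compact.
move=> s; apply: cvgM; first exact: cf.
exact: (continuous_subspaceT cg).
Qed.

(** Where [q] is monotone, [q' ds] is a positive measure of mass q b - q a, so
    that integrating [f] against it averages [f]. *)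
Lemma Rintegral_monotone_mean a b f q q' C e : a <= b ->
  {within `[a, b], continuous f} ->
  (forall s, is_derive s 1 q (q' s)) -> continuous q' ->
  (forall s, a <= s <= b -> 0 <= q' s) ->
  (forall s, a <= s <= b -> `|f s - C| <= e) ->
  `|\int[mu]_(s in `[a, b]) (f s * q' s) - C * (q b - q a)| <= e * (q b - q a).
Proof.
move=> ab cf dq cq' q'0 fC.
have ccst (x : R) : {within `[a, b], continuous (cst x : R -> R)}.
  by apply: continuous_subspaceT => ?; exact: cvg_cst.
have iq x := integrable_cont_mul (ccst x) cq'.
have iq1 : mu.-integrable `[a, b] (EFin \o q').
  by have := iq 1; congr (_.-integrable _ _); apply/funext => s; rewrite /= mul1r.
rewrite -(Rintegral_derive ab dq cq') -!RintegralZl//.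
rewrite -RintegralB//; last 2 first.
- exact: integrable_cont_mul.
- exact: (iq C).
have cf' : {within `[a, b], continuous (fun s => f s - C)}.
  by move=> s; apply: cvgB; [exact: cf|exact: cvg_cst].
have H := integrable_cont_mul cf' cq'.
under eq_Rintegral do rewrite -mulrBl.
apply: le_trans (le_normr_Rintegral _ H) _ => //.
apply: le_Rintegral => //.
- exact: (integrable_norm H).
- exact: iq.
move=> s /=; rewrite in_itv/= => sab.
by rewrite normrM (ger0_norm (q'0 _ sab)) ler_wpM2r// ?q'0// fC.
Qed.

Lemma Rintegral_antitone_mean a b f q q' C e : a <= b ->
  {within `[a, b], continuous f} ->
  (forall s, is_derive s 1 q (q' s)) -> continuous q' ->
  (forall s, a <= s <= b -> q' s <= 0) ->
  (forall s, a <= s <= b -> `|f s - C| <= e) ->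
  `|\int[mu]_(s in `[a, b]) (f s * q' s) - C * (q b - q a)| <= e * (q a - q b).
Proof.
move=> ab cf dq cq' q'0 fC.
have dNq s : is_derive s 1 (\- q) (- q' s) by exact: is_deriveN.
have cNq : continuous (\- q') by move=> s; apply: cvgN; exact: cq'.
have Nq'0 s : a <= s <= b -> 0 <= (\- q') s by move=> /q'0 /=; rewrite oppr_ge0.
have := Rintegral_monotone_mean ab cf dNq cNq Nq'0 fC.
under eq_Rintegral do rewrite /= mulrN -mulN1r.
rewrite RintegralZl//; last exact: integrable_cont_mul.
set I := Rintegral _ _ _ => /= H.
have -> : I - C * (q b - q a) = - (-1 * I - C * (- q b - - q a)) by ring.
by rewrite normrN (le_trans H)// opprK addrC.
Qed.

Lemma within_dist_le a b f s0 e : {within `[a, b], continuous f} -> a <= s0 <= b -> 0 < e ->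
  exists2 d : R, 0 < d & forall s, a <= s <= b -> `|s - s0| < d -> `|f s - f s0| <= e.
Proof.
move=> cf s0ab e0.
have /subspace_continuousP/(_ s0) := cf; rewrite /= in_itv/= => /(_ s0ab).
move=> /cvgrPdist_le/(_ _ e0); rewrite near_withinE => -[d d0 H].
exists d => // s sab sd; rewrite distrC; apply: H => /=; last by rewrite in_itv.
by rewrite distrC.
Qed.

Lemma within_osc_bounded a b f : {within `[a, b], continuous f} ->
  exists2 M : R, 0 < M & forall s t, a <= s <= b -> a <= t <= b -> `|f s - f t| <= M.
Proof.
move=> cf; have [ab|ba] := leP a b; last first.
  by exists 1 => // s t /andP[h1 h2] _; have := le_trans h1 h2; rewrite leNgt ba.
have [x xab Hx] := EVT_max ab cf; have [y yab Hy] := EVT_min ab cf.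
exists (f x - f y + 1).
  by rewrite ltr_wpDl// subr_ge0 Hy.
move=> s t sab tab; rewrite ler_norml.
have := Hx s; have := Hx t; have := Hy s; have := Hy t; rewrite !in_itv/= => /(_ tab) + /(_ sab) + /(_ tab) + /(_ sab).
by lra.
Qed.

(** The measure [dbump c d n s ds] tends to the difference of the Dirac masses
    at [c] and [d].  Near [c] and near [d], [f] is almost constant; on the two
    middle pieces the total variation of [bump c d n] tends to 0, since the
    bump already is close to 1 at c + k, at the midpoint and at d - k. *)
Lemma cvg_Rintegral_dbump c d f : c < d -> {within `[c, d], continuous f} ->
  \int[mu]_(s in `[c, d]) (f s * dbump c d n s) @[n --> \oo] --> f c - f d.
Proof.
move=> cd cf; have [M M0 HM] := within_osc_bounded cf.
apply/cvgrPdist_le => /= e e0.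
have e8 : 0 < e / 8 by rewrite divr_gt0.
pose m := (c + d) / 2.
have cI : c <= c <= d by lra.
have dI : c <= d <= d by lra.
have [d1 d10 H1] := within_dist_le cf cI e8.
have [d2 d20 H2] := within_dist_le cf dI e8.
have m0 : 0 < m - c by rewrite /m; lra.
have [k kH] : exists k : R, [&& 0 < k, k < d1, k < d2 & k < m - c].
  pose k0 : R := Num.min d1 (Num.min d2 (m - c)).
  have k00 : 0 < k0 by rewrite !lt_min d10 d20.
  have k01 : k0 <= d1 by rewrite ge_min lexx.
  have k02 : k0 <= d2 by rewrite !ge_min lexx orbT.
  have k03 : k0 <= m - c by rewrite !ge_min lexx !orbT.
  by exists (k0 / 2); lra.
have hk : c < c + k < d by rewrite /m in kH; lra.
have hk' : c < d - k < d by rewrite /m in kH; lra.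
have hm : c < m < d by rewrite /m; lra.
have km : c + k <= m by lra.
have mk : m <= d - k by rewrite /m in kH *; lra.
have mE : m = (c + d) / 2 by [].
clearbody m.
have e8M : 0 < e / 8 / M by rewrite divr_gt0.
near=> n.
have B1 : `|1 - bump c d n (c + k)| <= e / 8 / M.
  by near: n; have /cvgrPdist_le := cvg_bump hk; apply.
have B2 : `|1 - bump c d n (d - k)| <= e / 8 / M.
  by near: n; have /cvgrPdist_le := cvg_bump hk'; apply.
have B3 : `|1 - bump c d n m| <= e / 8 / M.
  by near: n; have /cvgrPdist_le := cvg_bump hm; apply.
have b0 : bump c d n c = 0 by apply: bump_out => //; rewrite ltxx.
have b1 : bump c d n d = 0 by apply: bump_out => //; rewrite ltxx andbF.
have dB := is_derive_bump c d n.
have cB := @continuous_dbump R c d n.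
have i0 := integrable_cont_mul cf cB.
have sub x y : c <= x -> y <= d -> `[x, y]%classic `<=` `[c, d]%classic.
  by move=> cx yd z /=; rewrite !in_itv/=; lra.
have cfs x y : c <= x -> y <= d -> {within `[x, y], continuous f}.
  by move=> cx yd; apply: continuous_subspaceW cf; exact: sub.
have is_ x y : c <= x -> y <= d -> mu.-integrable `[x, y] (EFin \o (fun s => f s * dbump c d n s)).
  by move=> cx yd; apply: integrableS i0 => //; exact: sub.
have sideW : [/\ c <= m, m <= d, c <= c + k, d - k <= d & c <= d - k] /\ c + k <= d.
  by clear -kH hm km mk; split; [split|]; lra.
case: sideW => -[cm md cck dkd cdk] ckd.
rewrite (@Rintegral_cut _ c m d)//.
rewrite (@Rintegral_cut _ c (c + k) m)//; last exact: is_.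
rewrite (@Rintegral_cut _ m (d - k) d)//; last exact: is_.
have P1 : `|\int[mu]_(s in `[c, c + k]) (f s * dbump c d n s) - f c * (bump c d n (c + k) - bump c d n c)|
    <= e / 8 * (bump c d n (c + k) - bump c d n c).
  apply: (@Rintegral_monotone_mean _ _ _ (bump c d n) (dbump c d n)) => //.
  - exact: cfs.
  - by move=> s hs; apply: dbump_ge0; clear -hs kH hm km mk mE; lra.
  - by move=> s hs; apply: H1; rewrite ?ltr_norml; clear -hs kH hm km mk mE; lra.
have P2 : `|\int[mu]_(s in `[c + k, m]) (f s * dbump c d n s) - f c * (bump c d n m - bump c d n (c + k))|
    <= M * (bump c d n m - bump c d n (c + k)).
  apply: (@Rintegral_monotone_mean _ _ _ (bump c d n) (dbump c d n)) => //.
  - exact: cfs.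
  - by move=> s hs; apply: dbump_ge0; clear -hs kH hm km mk mE; lra.
  - by move=> s hs; apply: HM; clear -hs kH hm km mk mE; lra.
have P3 : `|\int[mu]_(s in `[m, d - k]) (f s * dbump c d n s) - f d * (bump c d n (d - k) - bump c d n m)|
    <= M * (bump c d n m - bump c d n (d - k)).
  apply: (@Rintegral_antitone_mean _ _ _ (bump c d n) (dbump c d n)) => //.
  - exact: cfs.
  - by move=> s hs; apply: dbump_le0; clear -hs kH hm km mk mE; lra.
  - by move=> s hs; apply: HM; clear -hs kH hm km mk mE; lra.
have P4 : `|\int[mu]_(s in `[d - k, d]) (f s * dbump c d n s) - f d * (bump c d n d - bump c d n (d - k))|
    <= e / 8 * (bump c d n (d - k) - bump c d n d).
  apply: (@Rintegral_antitone_mean _ _ _ (bump c d n) (dbump c d n)) => //.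
  - exact: cfs.
  - by move=> s hs; apply: dbump_le0; clear -hs kH hm km mk mE; lra.
  - by move=> s hs; apply: H2; rewrite ?ltr_norml; clear -hs kH hm km mk mE; lra.
have P5 : `|(f c - f d) * (1 - bump c d n m)| <= M * (e / 8 / M).
  by rewrite normrM ler_pM// HM.
have MeM : M * (e / 8 / M) = e / 8 by rewrite mulrC divfK// gt_eqF.
have e8le x : x <= 1 -> e / 8 * x <= e / 8 by move=> x1; rewrite ler_piMr// ltW.
have Mle x y : `|1 - x| <= e / 8 / M -> y <= 1 -> M * (y - x) <= e / 8.
  move=> hx hy; rewrite -MeM ler_pM2l// (le_trans _ hx)// (le_trans _ (ler_norm _))//.
  by rewrite lerD2r.
have /andP[_ u1] := bump_itv c d n (c + k).
have /andP[_ u2] := bump_itv c d n (d - k).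
have /andP[_ u3] := bump_itv c d n m.
have Q1 := Mle _ _ B1 u3.
have Q2 := Mle _ _ B2 u3.
have Q3 := e8le _ u1.
have Q4 := e8le _ u2.
move: P1 P2 P3 P4 P5; rewrite b0 b1 !subr0 sub0r MeM.
move: (Rintegral _ _ _) (Rintegral _ _ _) (Rintegral _ _ _) (Rintegral _ _ _) => I1 I2 I3 I4.
rewrite !ler_norml => P1 P2 P3 P4 P5.
clear -P1 P2 P3 P4 P5 Q1 Q2 Q3 Q4 e0.
move: (bump c d n m) (bump c d n (c + k)) (bump c d n (d - k)) P1 P2 P3 P4 P5 Q1 Q2 Q3 Q4 => x y z.
rewrite !mulrBr !mulrN !mulrBl.
move: (M * x) (M * y) (M * z) (f c * x) (f c * y) (f d * x) (f d * z) (e / 8 * y) (e / 8 * z).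
by move=> ? ? ? ? ? ? ? ? ? ? ? ? ? ? ? ? ? ?; apply/andP; split; lra.
Unshelve. all: by end_near. Qed.

End weak_derivative.

Section weak_ftc.
Context {R : realType}.
Notation mu := (@lebesgue_measure R).
Implicit Types (f g h p q : R -> R) (a b c d e u v s C : R).

Lemma cvg_Rintegral_bump c d g : mu.-integrable `]c, d[ (EFin \o g) ->
  \int[mu]_(s in `]c, d[) (g s * bump c d n s) @[n --> \oo] --> \int[mu]_(s in `]c, d[) g s.
Proof.
move=> ig.
have mg : measurable_fun `]c, d[ g by apply/measurable_EFinP; exact: measurable_int ig.
have mb n : measurable_fun `]c, d[ (fun s => g s * bump c d n s).
  apply: measurable_funM => //; apply: measurable_funTS.
  by apply: continuous_measurable_fun; exact: continuous_bump.
have H : (\int[mu]_(s in `]c, d[) (g s * bump c d n s)%:E @[n --> \oo] --> \int[mu]_(s in `]c, d[) (g s)%:E)%E.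
  apply: (@dominated_cvg _ _ _ mu `]c, d[%classic (measurable_itv _)
    (fun n s => (g s * bump c d n s)%:E) (EFin \o g) (fun s => `|g s|%:E)).
  - by move=> n; apply/measurable_EFinP; exact: mb.
  - move=> s /=; rewrite in_itv/= => scd.
    apply: cvg_EFin; first by apply: nearW.
    rewrite -[X in _ --> X]mulr1; apply: cvgMl_tmp; exact: cvg_bump.
  - by [].
  - exact: integrable_norm ig.
  - move=> n s _ /=; rewrite lee_fin normrM ler_piMr//.
    by have /andP[h0 h1] := bump_itv c d n s; rewrite ger0_norm.
apply: fine_cvg; rewrite fineK//.
exact: integrable_fin_num.
Qed.

(** Hoelder's inequality against the indicator of the interval. *)
Lemma L2_integrable a b g : L2 a b g -> mu.-integrable setT (EFin \o (g \_ `]a, b[)).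
Proof.
move=> Lg; apply/Lfun1_integrable.
have L1 : \1_(`]a, b[) \in Lfun mu 2%:E.
  rewrite inE; apply/andP; split; rewrite inE/=; first exact: measurable_indic.
  rewrite /finite_norm unlock.
  apply: poweR_lty.
  rewrite [X in (X < _)%E](_ : _ = (\int[mu]_s (\1_`]a, b[ s)%:E)%E); last first.
    apply: eq_integral => s _; rewrite /= indicE; case: (_ \in _) => /=.
      by rewrite normr1 powR1.
    by rewrite normr0 powR0.
  by apply: integrable_lty; [exact: measurableT|exact: (@integrable_indic_itv R a b false true)].
have := Lfun2_mul_Lfun1 Lg L1.
rewrite (_ : _ \* _ = g \_ `]a, b[)//; apply/funext => s; rewrite /= patchE indicE.
by case: ifP => h; rewrite ?mulr1 ?mul0r.
Qed.

(** The bumps over ]c, d[ are test functions; both sides of the definition of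
    the weak derivative converge. *)
Lemma weak_derivative_FTC_oo a b c d f g :
  a < c -> c < d -> d < b -> {within `[a, b], continuous f} ->
  mu.-integrable `]a, b[ (EFin \o g) -> weak_derivative a b f g ->
  f d - f c = \int[mu]_(s in `]c, d[) g s.
Proof.
move=> ac cd db cf ig wd.
have cdab : `[c, d]%classic `<=` `]a, b[%classic.
  by move=> s /=; rewrite !in_itv/=; lra.
have cdab' : `]c, d[%classic `<=` `]a, b[%classic.
  by move=> s /=; rewrite !in_itv/=; lra.
have cf' : {within `[c, d], continuous f}.
  by apply: continuous_subspaceW cf => s /=; rewrite !in_itv/=; lra.
have ig' : mu.-integrable `]c, d[ (EFin \o g) by exact: integrableS ig.
have H1 := cvg_Rintegral_dbump cd cf'.
have H2 := cvg_Rintegral_bump ig'.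
have H n : \int[mu]_(s in `[c, d]) (f s * dbump c d n s) =
    - \int[mu]_(s in `]c, d[) (g s * bump c d n s).
  have := wd _ (bump_test n ac cd db).
  rewrite derive1_bump (@Rintegral_subset _ _ `[c, d]%classic)//; last first.
    move=> s _ /negP; rewrite /= in_itv/= => hs.
    rewrite dbump_out ?mulr0//; apply: contra hs; lra.
  move=> ->; congr (- _); apply: Rintegral_subset => //.
  move=> s _ /negP; rewrite /= in_itv/= => hs.
  by rewrite bump_out// mulr0.
move: H1; under eq_cvg do rewrite H.
move=> /cvgN; under eq_cvg do rewrite opprK.
move=> H1; have := cvg_unique _ H1 H2.
by move=> /(_ (@norm_hausdorff _ _)) <-; rewrite opprB.
Qed.

(** The primitive of the weak derivative [g] differs from [f] by a constant, on
    the closed interval by continuity; Lebesgue differentiation of that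
    primitive gives the last claim.  Extending [g] by 0 makes it integrable on
    the whole line. *)
Lemma W12_FTC a b f : a < b -> {within `[a, b], continuous f} -> W12 a b f ->
  exists g, [/\ mu.-integrable setT (EFin \o g),
    (forall x y, a <= x -> x <= y -> y <= b -> f y - f x = \int[mu]_(s in `[x, y]) g s) &
    {ae mu, forall s, a < s < b -> derive1 f s = g s}].
Proof.
move=> ab cf [_ [g0 [Lg0 wd]]]; pose g := g0 \_ `]a, b[.
have ig : mu.-integrable setT (EFin \o g) by exact: L2_integrable.
have igS (A : set R) : measurable A -> mu.-integrable A (EFin \o g).
  by move=> mA; apply: integrableS ig.
have ig0 : mu.-integrable `]a, b[ (EFin \o g0).
  have := igS `]a, b[%classic (measurable_itv _).
  apply: eq_integrable => // s sab; rewrite /= /g patchE sab//.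
pose F x := \int[mu]_(s in `[a, x]) g s.
have Fxy x y : a <= x -> x <= y -> F y - F x = \int[mu]_(s in `[x, y]) g s.
  move=> ax xy; rewrite /F (Rintegral_cut ax xy); last exact: igS.
  by rewrite addrAC subrr add0r.
have fF x y : a < x -> x < y -> y < b -> f y - f x = F y - F x.
  move=> ax xy yb; rewrite Fxy ?ltW// (weak_derivative_FTC_oo ax xy yb cf ig0 wd).
  rewrite -(@Rintegral_itv_obnd_cbnd _ x); last exact: igS.
  rewrite -(@Rintegral_itv_bndo_bndc _ _ y); last exact: igS.
  apply: eq_Rintegral => s; rewrite inE/= in_itv/= => sxy.
  by rewrite /g patchE mem_set//= in_itv/=; lra.
pose m := (a + b) / 2.
have mab : a < m < b by rewrite /m; lra.
pose h x := f x - F x.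
have hm x : a < x < b -> h x = h m.
  move=> xab; rewrite /h; have [xm|mx|->//] := ltgtP x m.
    by have := @fF x m; lra.
  by have := @fF m x; lra.
have ch : {within `[a, b], continuous h}.
  move=> s; apply: cvgB; first exact: cf.
  exact: (parameterized_integral_continuous (ltW ab) (igS _ (measurable_itv _))).
have [_ ha hb] := (continuous_within_itvP h ab).1 ch.
have hcst x : a <= x <= b -> h x = h m.
  move=> /andP[]; rewrite le_eqVlt => /predU1P[<- _|ax].
    apply: (cvg_unique (@Rhausdorff R) ha).
    have : cst (h m) x @[x --> a^'+] --> h m by exact: cvg_cst.
    apply: cvg_trans; apply: near_eq_cvg; near=> z.
    by rewrite /cst hm//; apply/andP; split; near: z; [exact: nbhs_right_gt|exact: nbhs_right_lt].
  rewrite le_eqVlt => /predU1P[->|xb]; last by rewrite hm// ax.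
  apply: (cvg_unique (@Rhausdorff R) hb).
  have : cst (h m) x @[x --> b^'-] --> h m by exact: cvg_cst.
  apply: cvg_trans; apply: near_eq_cvg; near=> z.
  by rewrite /cst hm//; apply/andP; split; near: z; [exact: nbhs_left_gt|exact: nbhs_left_lt].
exists g; split => //.
  move=> x y ax xy yb; rewrite -Fxy//.
  by have := hcst x; have := hcst y; rewrite /h; lra.
have locg : locally_integrable [set: R] g by apply: open_integrable_locally => //; exact: openT.
have := @FTC1 R g (BLeft a) (fun y => igS _ (measurable_itv _)) locg.
apply: filterS; first exact: (ae_filter_ringOfSetsType mu).
move=> s /= H sab.
have /H[dF <-] : (a%:E < s%:E)%E by rewrite lte_fin; case/andP: sab.
rewrite -/F in dF *.
rewrite !derive1E; apply: etrans (_ : 'D_1 (cst (h m) + F) s = _); last first.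
  by rewrite deriveD// derive_cst add0r.
apply: near_eq_derive; near=> z.
have : h z = h m.
  by apply: hm; apply/andP; split; near: z; [apply: lt_nbhsr|apply: lt_nbhsl]; lra.
by rewrite /h => H1; rewrite fctE /= -H1 subrK.
Unshelve. all: by end_near. Qed.
End weak_ftc.

(** * Integrals against an increasing kernel *)

Section kernel.
Context {R : realType}.
Notation mu := (@lebesgue_measure R).
Implicit Types (g w k : R -> R) (a b x y s L : R).

(** On a uniform partition into N pieces the possible drops telescope to
    L (b - a) (V b - V a) / N. *)
Lemma nondecreasing_of_small_drop a b L (Phi V : R -> R) : a <= b ->
  (forall x y, a <= x -> x <= y -> y <= b ->
    Phi x - L * (y - x) * (V y - V x) <= Phi y) ->
  Phi a <= Phi b.
Proof.
move=> ab H; apply/ler_addgt0Pr => e e0.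
pose C := L * (b - a) * (V b - V a).
have [n nC] : exists n : nat, C / e <= n.+1%:R.
  exists (Num.truncn `|C / e|); rewrite (le_trans (ler_norm _))// ltW// truncnS_gt//.
pose h := (b - a) / n.+1%:R.
have h0 : 0 <= h by rewrite divr_ge0// subr_ge0.
have hE : n.+1%:R * h = b - a by rewrite /h mulrC divfK// pnatr_eq0.
have step i : (i <= n.+1)%N -> Phi a - L * h * (V (a + i%:R * h) - V a) <= Phi (a + i%:R * h).
  elim: i => [_|i IH iN]; first by rewrite mul0r addr0 subrr mulr0 subr0.
  have ih : i.+1%:R * h <= b - a by rewrite -hE ler_wpM2r// ler_nat.
  have i0 : 0 <= i%:R * h by rewrite mulr_ge0.
  have iS : i.+1%:R * h = i%:R * h + h by rewrite -natr1 mulrDl mul1r.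
  have := IH (ltnW iN); have := H (a + i%:R * h) (a + i.+1%:R * h).
  rewrite (_ : a + i.+1%:R * h - _ = h); last by rewrite iS; ring.
  have [p q w'] : [/\ a <= a + i%:R * h, a + i%:R * h <= a + i.+1%:R * h &
    a + i.+1%:R * h <= b] by split; lra.
  move=> /(_ p q w') {p q w'}.
  move: (Phi _) (Phi _) (Phi _) (V _) (V _) (V _) (L * h) => p1 p2 p3 v1 v2 v3 z.
  by clear; nra.
have := step _ (leqnn _); rewrite hE [a + _]addrC subrK.
rewrite lerBlDr => /le_trans; apply; rewrite lerD2l.
rewrite /h mulrA mulrAC -/C ler_pdivrMr// mulrC -ler_pdivrMr//.
Qed.

(** The kernel [k] may blow up at [b], where its value is arbitrary; whence
    the normalisation [g b = 0].  For smooth [w] the claim is an integration by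
    parts. *)
Lemma monotone_kernel_ge a b k w g : a < b ->
  (forall s, a <= s < b -> 0 <= k s) ->
  (forall x y, a <= x -> x <= y -> y < b -> k x <= k y) ->
  (forall r, a <= r < b -> exists L, forall x y, a <= x -> x <= y -> y <= r ->
     k y - k x <= L * (y - x)) ->
  mu.-integrable `[a, b] (EFin \o g) ->
  mu.-integrable `[a, b] (EFin \o (fun s => k s * g s)) ->
  g b = 0 ->
  (forall x y, a <= x -> x <= y -> y <= b -> w y - w x = \int[mu]_(s in `[x, y]) g s) ->
  (forall s, a <= s <= b -> w s <= w b) ->
  k a * (w b - w a) <= \int[mu]_(s in `[a, b]) (k s * g s).
Proof.
move=> ab k0 kmono klip ig ikg gb wg wmax.
pose K s := k s * g s.
have igs x y : a <= x -> y <= b -> mu.-integrable `[x, y] (EFin \o g).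
  move=> ax yb; apply: integrableS ig => //; apply: subset_itv; by rewrite bnd_simp.
have iKs x y : a <= x -> y <= b -> mu.-integrable `[x, y] (EFin \o K).
  move=> ax yb; apply: integrableS ikg => //; apply: subset_itv; by rewrite bnd_simp.
have ings x y : a <= x -> y <= b -> mu.-integrable `[x, y] (EFin \o (fun s => `|g s|)).
  by move=> ax yb; exact: integrable_norm (igs _ _ _ _).
have inKs x y : a <= x -> y <= b -> mu.-integrable `[x, y] (EFin \o (fun s => `|K s|)).
  by move=> ax yb; exact: integrable_norm (iKs _ _ _ _).
have icg c x y : a <= x -> y <= b -> mu.-integrable `[x, y] (EFin \o (fun s => c * g s)).
  by move=> ax yb; apply: (integrableZl _ c (igs _ _ ax yb)).
have icng c x y : a <= x -> y <= b -> mu.-integrable `[x, y] (EFin \o (fun s => c * `|g s|)).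
  by move=> ax yb; apply: (integrableZl _ c (ings _ _ ax yb)).
pose Phi r := \int[mu]_(s in `[a, r]) K s + k r * (w b - w r).
pose V r := \int[mu]_(s in `[a, r]) `|g s|.
have mono r : a <= r < b -> k a * (w b - w a) <= Phi r.
  move=> rab; have /andP[ar rb] := rab.
  have [L HL] := klip _ rab.
  have -> : k a * (w b - w a) = Phi a by rewrite /Phi set_itv1 Rintegral_set1 add0r.
  apply: (@nondecreasing_of_small_drop _ _ L Phi V) => // x y ax xy yr.
  have yb : y <= b by lra.
  have iD : mu.-integrable `[x, y] (EFin \o (fun s => K s - k x * g s)).
    exact: (integrableB _ (iKs _ _ ax yb) (icg (k x) _ _ ax yb)).
  (* over [x, y], [w b - w] is replaced by [w b - w y] at the cost of the
     first integral *)
  have E : Phi y - Phi x = \int[mu]_(s in `[x, y]) (K s - k x * g s) + (k y - k x) * (w b - w y).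
    rewrite RintegralB//; [|exact: iKs|exact: icg].
    rewrite RintegralZl//; last exact: igs.
    rewrite -wg// /Phi (Rintegral_cut ax xy); last exact: iKs.
    by ring.
  have E2 : `|\int[mu]_(s in `[x, y]) (K s - k x * g s)| <= (k y - k x) * \int[mu]_(s in `[x, y]) `|g s|.
    apply: le_trans (le_normr_Rintegral _ iD) _ => //.
    rewrite -RintegralZl//; last exact: ings.
    apply: le_Rintegral => //; [exact: integrable_norm iD|exact: icng|].
    move=> s /=; rewrite in_itv/= => /andP[xs sy].
    rewrite /K -mulrBl normrM ler_wpM2r//.
    have yltb := le_lt_trans yr rb.
    have h1 := kmono x s ax xs (le_lt_trans sy yltb).
    have h2 := kmono s y (le_trans ax xs) sy yltb.
    by rewrite ger0_norm; lra.
  have E3 : V y - V x = \int[mu]_(s in `[x, y]) `|g s|.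
    by rewrite /V (Rintegral_cut ax xy); [rewrite addrAC subrr add0r|exact: ings].
  have I0 : 0 <= \int[mu]_(s in `[x, y]) `|g s| by apply: Rintegral_ge0.
  have kxy := HL _ _ ax xy yr.
  have kxy0 := kmono x y ax xy (le_lt_trans yr rb).
  have wby : 0 <= w b - w y by rewrite subr_ge0; apply: wmax; rewrite (le_trans ax xy) yb.
  have p1 := mulr_ge0 (_ : 0 <= k y - k x) wby.
  have p2 : (k y - k x) * (V y - V x) <= L * (y - x) * (V y - V x).
    by rewrite ler_wpM2r// E3.
  have {}p1 : 0 <= (k y - k x) * (w b - w y) by apply: p1; rewrite subr_ge0.
  move: E2 E p1 p2; rewrite -E3 ler_norml; clear.
  move: (Rintegral _ _ _) (Phi x) (Phi y) (_ * (w b - w y)) (_ * (V y - V x)) (_ * _ * (V y - V x)).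
  by move=> i p q u v z; lra.
(* k r <= k s on [r, b[, so the boundary term is a tail of the integral of |K| *)
have tail r : a <= r < b -> k r * (w b - w r) <= \int[mu]_(s in `[r, b]) `|K s|.
  move=> /andP[ar rb]; rewrite wg//; last exact: ltW.
  rewrite -RintegralZl//; last exact: igs.
  apply: le_Rintegral => //; [exact: icg|exact: inKs|].
  move=> s /=; rewrite in_itv/= => /andP[rs]; rewrite le_eqVlt => /predU1P[->|sb].
    by rewrite gb mulr0.
  rewrite /K normrM (le_trans (ler_norm _))// normrM ler_wpM2r//.
  have h1 : 0 <= k r by apply: k0; rewrite ar.
  have h2 := kmono r s ar rs sb.
  by rewrite !ger0_norm//; lra.
pose A r := \int[mu]_(s in `[a, r]) K s - \int[mu]_(s in `[a, r]) `|K s|.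
have cA : A r @[r --> b^'-] --> A b.
  apply: cvgB; apply: parameterized_integral_cvg_at_left => //.
  exact: inKs.
suff : k a * (w b - w a) - \int[mu]_(s in `[a, b]) `|K s| <= A b.
  by rewrite /A lerD2r.
apply: (cvgr_to_ge cA); near=> r.
have rab : a <= r < b.
  apply/andP; split; near: r; [apply: nbhs_left_ge|exact: nbhs_left_lt]; by [].
have /andP[ar rb] := rab.
have := mono _ rab; have := tail _ rab; rewrite /Phi /A.
rewrite (@Rintegral_cut _ (fun s => `|K s|) a r b)//; last exact: inKs.
move: (Rintegral _ _ _) (Rintegral _ _ _) (Rintegral _ _ _) (k r * _) (k a * _); clear.
by move=> i j l p q; lra.
Unshelve. all: by end_near. Qed.

End kernel.

Section log_kernel.
Context {R : realType}.
Implicit Types (alpha t s x y r : R).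

Definition log_kernel alpha t s : R := ln (t / s) `^ (- alpha).

Lemma ln_ratio_gt0 t s : 0 < s -> s < t -> 0 < ln (t / s).
Proof. by move=> s0 st; rewrite ln_gt0// ltr_pdivlMr ?mul1r. Qed.

Lemma ler_ln_ratio t x y : 1 <= x -> x <= y -> y < t -> ln (t / y) <= ln (t / x).
Proof.
move=> x1 xy yt; have x0 : 0 < x by exact: lt_le_trans x1.
have y0 : 0 < y by exact: lt_le_trans xy.
have t0 : 0 < t by exact: lt_trans yt.
by rewrite ler_ln ?posrE ?divr_gt0// ler_pM2l// lef_pV2.
Qed.

Lemma ler_neg_powR p x y : 0 <= p -> 0 < x -> x <= y -> y `^ (- p) <= x `^ (- p).
Proof.
move=> p0 x0 xy; rewrite !powRN lef_pV2 ?posrE ?powR_gt0//; last exact: lt_le_trans xy.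
by apply: ge0_ler_powR; rewrite ?nnegrE// ltW//; exact: lt_le_trans xy.
Qed.

Lemma log_kernel_nondecreasing alpha t x y : 0 < alpha ->
  1 <= x -> x <= y -> y < t -> log_kernel alpha t x <= log_kernel alpha t y.
Proof.
move=> alpha_gt0 x1 xy yt; apply: ler_neg_powR; first exact: ltW.
  by apply: ln_ratio_gt0 => //; rewrite (lt_le_trans _ (le_trans x1 xy)).
exact: ler_ln_ratio.
Qed.

Lemma is_derive_log_kernel alpha t s : 0 < s -> s < t ->
  is_derive s 1 (log_kernel alpha t) (alpha * ln (t / s) `^ (- alpha - 1) / s).
Proof.
move=> s0 st.
have t0 : 0 < t by exact: lt_trans st.
have dln : is_derive s 1 (fun s => ln (t / s)) (- s^-1).
  have H : is_derive s 1 (cst (ln t) - (@ln R)) (0 - s^-1).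
    by apply: is_deriveB; exact: is_derive1_ln.
  rewrite sub0r in H; apply: near_eq_is_derive H; near=> z.
  have z0 : 0 < z by near: z; exact: lt_nbhsr.
  by rewrite ln_div ?posrE.
have dp := @is_derive1_powR R (- alpha) _ (ln_ratio_gt0 s0 st).
have dc : is_derive s 1 (log_kernel alpha t) (- alpha * ln (t / s) `^ (- alpha - 1) * - s^-1) by exact: (@is_derive1_comp R (@powR R ^~ (- alpha)) (fun s => ln (t / s)) s _ _ dp dln).
apply: is_derive_eq dc _.
by rewrite mulrN !mulNr opprK.
Unshelve. all: by end_near. Qed.

Lemma log_kernel_lipschitz alpha t r : 0 < alpha -> 1 <= r < t ->
  exists L, forall x y, 1 <= x -> x <= y -> y <= r ->
  log_kernel alpha t y - log_kernel alpha t x <= L * (y - x).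
Proof.
move=> alpha_gt0 /andP[r1 rt]; exists (alpha * ln (t / r) `^ (- alpha - 1)) => x y x1 xy yr.
move: xy; rewrite le_eqVlt => /predU1P[->|xy]; first by rewrite !subrr mulr0.
have yt : y < t by exact: le_lt_trans rt.
have xyI z : z \in `[x, y] -> [/\ 0 < z, 1 <= z, z <= r & z < t].
  rewrite in_itv/= => /andP[xz zy]; have z1 := le_trans x1 xz.
  by split; [exact: lt_le_trans z1|exact: z1|exact: le_trans yr|exact: le_lt_trans yt].
have [||z zxy ->] := @MVT_segment _ (log_kernel alpha t) (fun s => alpha * ln (t / s) `^ (- alpha - 1) / s) x y (ltW xy).
- by move=> z zxy; apply: is_derive_log_kernel; have [] := xyI _ (subset_itv_oo_cc zxy).
- apply: derivable_within_continuous => z zxy.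
  by have [z0 _ _ zt] := xyI _ zxy; have [] := is_derive_log_kernel alpha z0 zt.
have [z0 z1 zr zt] := xyI _ zxy.
rewrite ler_wpM2r ?subr_ge0 ?(ltW xy)// ler_pdivrMr//.
apply: (@le_trans _ _ (alpha * ln (t / r) `^ (- alpha - 1))); last first.
  by rewrite ler_peMr// mulr_ge0 ?powR_ge0// ltW.
rewrite ler_pM2l// -opprD; apply: ler_neg_powR.
- by rewrite addr_ge0// ltW.
- by apply: ln_ratio_gt0 => //; exact: lt_le_trans r1.
- exact: ler_ln_ratio.
Qed.
End log_kernel.

(** * The Gamma integral *)

Section gamma.
Context {R : realType}.
Notation mu := (@lebesgue_measure R).

Let bigcup_inv : \bigcup_n `[n.+1%:R^-1, (1 : R)]%classic = `]0, 1]%classic.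
Proof.
apply/seteqP; split => x /=.
  move=> [n _]; rewrite /= !in_itv/= => /andP[h1 ->]; rewrite andbT.
  by apply: lt_le_trans h1; rewrite invr_gt0.
rewrite in_itv/= => /andP[x0 x1].
exists (Num.truncn x^-1) => //=; rewrite in_itv/= x1 andbT.
rewrite invf_ple ?posrE// ltW// truncnS_gt//.
Qed.

Lemma measurable_gamma_integrand (z : R) D : measurable D ->
  measurable_fun D (fun x : R => x `^ (z - 1)%R * expR (- x)).
Proof.
move=> mD; apply: measurable_funM; apply: measurable_funTS.
  exact: measurable_powR.
by apply: measurableT_comp => //; exact: measurable_oppr.
Qed.

(** The integrand is singular at 0: integrate over [1 / (n + 1), 1] and let n
    grow. *)
Lemma integral_powR_lty (z : R) : 0 < z -> (\int[mu]_(x in `]0%R, 1%R]) (x `^ (z - 1))%R%:E < +oo)%E.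
Proof.
move=> z0; apply: (@le_lt_trans _ _ (z^-1)%:E); last exact: ltry.
rewrite -bigcup_inv.
have mp D : measurable D -> measurable_fun D (fun x : R => (x `^ (z - 1))%R%:E).
  move=> mD; apply/measurable_EFinP; apply: measurable_funTS; exact: measurable_powR.
have H := @ge0_nondecreasing_set_cvg_integral _ (measurableTypeR R) R (fun n => `[n.+1%:R^-1, (1 : R)]%classic)
  (fun x => (x `^ (z - 1))%R%:E) mu.
apply: (cvge_to_le (H _ _ _ _)).
- apply/nondecreasing_seqP => n; apply/subsetPset => x /=; rewrite !in_itv/= => /andP[h ->].
  by rewrite andbT (le_trans _ h)// lef_pV2 ?posrE// ler_nat.
- by move=> n; exact: measurable_itv.
- by move=> n; apply: mp.
- by move=> n x _; rewrite lee_fin powR_ge0.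
apply: nearW => n.
have n0 : (0 : R) < n.+1%:R^-1 by rewrite invr_gt0.
have : n.+1%:R^-1 <= (1 : R) by rewrite invf_le1// ler1n.
rewrite le_eqVlt => /predU1P[->|n1].
  by rewrite set_itv1 integral_set1 lee_fin invr_ge0 ltW.
have dF (x : R) : 0 < x -> is_derive x 1 (fun x : R => z^-1 * x `^ z) (x `^ (z - 1)%R).
  move=> x0; have := @is_derive1_powR R z x x0 => dp.
  apply: is_derive_eq (is_deriveZ z^-1 dp) _.
  by rewrite /GRing.scale/= mulrA mulVf ?mul1r// gt_eqF.
rewrite (@continuous_FTC2 _ _ (fun x => z^-1 * x `^ z))//.
- by rewrite -EFinB lee_fin powR1 mulr1 gerBl mulr_ge0// ?powR_ge0// invr_ge0 ltW.
- apply: derivable_within_continuous => x; rewrite in_itv/= => /andP[nx _].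
  by apply: derivable_powR; rewrite in_itv/= andbT (lt_le_trans n0).
- have cF (x : R) : 0 < x -> {for x, continuous (fun x : R => z^-1 * x `^ z)}.
    by move=> x0; apply: differentiable_continuous; apply/derivable1_diffP; have [] := dF x x0.
  split.
  + by move=> x; rewrite in_itv/= => /andP[nx _]; have [] := dF x (lt_trans n0 nx).
  + by apply: cvg_at_right_filter; exact: cF.
  + by apply: cvg_at_left_filter; exact: cF.
- by move=> x; rewrite in_itv/= => /andP[nx _]; rewrite derive1E; have [_ ->] := dF x (lt_trans n0 nx).
Qed.

Lemma integral_expRN_lty : (\int[mu]_(x in `[1%R, +oo[) ((expR (- x))%R%:E) < +oo)%E.
Proof.
have dF (x : R) : is_derive x 1 (fun x : R => - expR (- x)) (expR (- x)).
  have dN : is_derive x 1 (fun x : R => - x) (-1) by exact: is_deriveN.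
  have dE := @is_derive1_comp _ _ _ _ _ _ (is_derive_expR (- x)) dN.
  by apply: is_derive_eq (is_deriveN dE) _; rewrite mulrN1 opprK.
have cF : continuous (fun x : R => - expR (- x)).
  by move=> x; apply: differentiable_continuous; apply/derivable1_diffP; have [] := dF x.
rewrite (@ge0_continuous_FTC2y _ _ (fun x => - expR (- x)) 1 0).
- by rewrite -EFinB ltry.
- by move=> x _; exact: expR_ge0.
- apply: continuous_subspaceT => x; apply: continuous_comp; [exact: opp_continuous|exact: continuous_expR].
- rewrite -oppr0; apply: cvgN; exact: cvgr_expR.
- by move=> x _; have [] := dF x.
- by apply: cvg_at_right_filter; exact: cF.
- by move=> x _; rewrite derive1E; have [_ ->] := dF x.
Qed.

(** The integral is finite by comparison with x^(z - 1) on ]0, 1] and with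
    exp (- x) beyond; it is positive because the integrand is at least
    exp (- 2) / 2 on [1, 2]. *)
Lemma Gamma_gt0 (z : R) : 0 < z < 1 -> 0 < Gamma z.
Proof.
move=> /andP[z0 z1]; rewrite /Gamma.
pose f (x : R) := x `^ (z - 1)%R * expR (- x).
have f0 x : 0 <= f x by rewrite mulr_ge0 ?powR_ge0 ?expR_ge0.
have mf D : measurable D -> measurable_fun D (fun x => (f x)%:E).
  by move=> mD; apply/measurable_EFinP; exact: measurable_gamma_integrand.
have itv01 : `](0 : R), +oo[%classic = `]0, 1]%classic `|` `](1:R), +oo[%classic.
  apply/seteqP; split => x /=; rewrite !in_itv/= ?andbT.
    by move=> ->; have [h|h] := leP x 1; [left|right].
  by move=> [/andP[]//|/(lt_trans ltr01)].
have fin : (\int[mu]_(x in `]0%R, +oo[) (f x)%:E < +oo)%E.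
  rewrite itv01 ge0_integral_setU//; last 3 first.
  - by apply: mf; apply: measurableU.
  - by move=> x _; rewrite lee_fin f0.
  - apply/disj_setPS => x [/=]; rewrite !in_itv/= andbT => /andP[_ h1] h2.
    by have := lt_le_trans h2 h1; rewrite ltxx.
  apply: lte_add_pinfty.
    apply: le_lt_trans (integral_powR_lty z0); apply: ge0_le_integral => //.
    - by move=> x _; rewrite lee_fin f0.
    - exact: mf.
    - apply/measurable_EFinP; apply: measurable_funTS; exact: measurable_powR.
    move=> x /=; rewrite in_itv/= => /andP[x0 _]; rewrite lee_fin ler_piMr ?powR_ge0//.
    by rewrite expR_le1 oppr_le0 ltW.
  apply: le_lt_trans integral_expRN_lty.
  have mE D : measurable D -> measurable_fun D (fun x : R => (expR (- x))%:E).
    move=> mD; apply/measurable_EFinP; apply: measurable_funTS.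
    by apply: measurableT_comp => //; exact: measurable_oppr.
  apply: (@le_trans _ _ (\int[mu]_(x in `]1%R, +oo[) (expR (- x))%R%:E)%E).
    apply: ge0_le_integral => //.
    - by move=> x _; rewrite lee_fin f0.
    - exact: mf.
    - exact: mE.
    move=> x /=; rewrite in_itv/= andbT => x1; rewrite lee_fin ler_piMl ?expR_ge0//.
    rewrite -[X in _ <= X](powRr0 x); apply: ler_powR; first exact: ltW.
    by rewrite subr_le0 ltW.
  apply: ge0_subset_integral => //; first exact: mE.
  by move=> x /=; rewrite !in_itv/= !andbT => /ltW.
pose c : R := 2^-1 * expR (- 2).
have c0 : 0 < c by rewrite mulr_gt0 ?invr_gt0 ?expR_gt0.
have low : (c%:E <= \int[mu]_(x in `]0%R, +oo[) (f x)%:E)%E.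
  apply: (@le_trans _ _ (\int[mu]_(x in `[1%R, 2%R]) (f x)%:E)%E); last first.
    apply: ge0_subset_integral => //; first exact: mf.
    - by move=> x _; rewrite lee_fin f0.
    - by move=> x /=; rewrite !in_itv/= andbT => /andP[/(lt_le_trans ltr01)].
  apply: (@le_trans _ _ (\int[mu]_(x in `[1%R, 2%R]) c%:E)%E).
    rewrite integral_cst//= lebesgue_measure_itv/= lte_fin ltr1n -EFinB -EFinM lee_fin.
    by rewrite (_ : 2 - 1 = 1 :> R) ?mulr1//; ring.
  apply: ge0_le_integral => //.
  - by move=> x _; rewrite lee_fin ltW.
  - exact: mf.
  move=> x /=; rewrite in_itv/= => /andP[x1 x2]; rewrite lee_fin ler_pM ?invr_ge0 ?expR_ge0//.
    apply: (@le_trans _ _ (x `^ (-1))); last by apply: ler_powR => //; rewrite lerBrDl subrr ltW.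
    by rewrite powR_inv1 ?(le_trans ler01)// lef_pV2 ?posrE// (lt_le_trans ltr01).
  by rewrite ler_expR lerN2.
have fn : (\int[mu]_(x in `]0%R, +oo[) (f x)%:E \is a fin_num)%E.
  by rewrite ge0_fin_numE// (le_trans _ low)// lee_fin ltW.
by apply: lt_le_trans c0 _; rewrite -lee_fin fineK.
Qed.
End gamma.

(** * Second derivatives at a maximum *)

Section second_derivative.
Context {R : realType} {n : nat}.
Implicit Types (f : 'rV[R]_n -> R) (G : set 'rV[R]_n) (x v : 'rV[R]_n).

Lemma derive_line f x v (h : R) :
  'D_v f (h *: v + x) = 'D_1 (fun k : R => f (k *: v + x)) h.
Proof.
rewrite /derive; set g1 := fun k => k^-1 *: _; set g2 := fun k => k^-1 *: _.
suff -> : g1 = g2 by [].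
by rewrite funeqE /g1 /g2 => k /=; rewrite [k *: 1]mulr1 scalerDl addrA.
Qed.

Lemma derivable_line f x v (h : R) :
  derivable f (h *: v + x) v -> derivable (fun k : R => f (k *: v + x)) h 1.
Proof.
rewrite /derivable; set g1 := fun k => k^-1 *: _; set g2 := fun k => k^-1 *: _.
suff -> : g1 = g2 by [].
by rewrite funeqE /g1 /g2 => k /=; rewrite [k *: 1]mulr1 scalerDl addrA.
Qed.

(** Otherwise the directional derivative, which vanishes at [x], would be
    positive on a segment issued from [x], and [f] would increase along it. *)
Lemma second_derive_le0_max f G x v : open G -> G x ->
  (forall y, G y -> derivable f y v) -> derivable ('D_v f) x v ->
  (forall y, G y -> f y <= f x) -> 'D_v ('D_v f) x <= 0.
Proof.
move=> oG Gx df ddf fmax.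
have [e e0 He] : exists2 e : R, 0 < e & forall h : R, `|h| < e -> G (h *: v + x).
  have : \forall h \near (0 : R), G (h *: v + x).
    have c : h *: v + x @[h --> (0 : R)] --> x.
      rewrite -[X in _ --> X]add0r -(scale0r v).
      apply: cvgD; last exact: cvg_cst.
      exact: scalel_continuous.
    by apply: c; exact: open_nbhs_nbhs.
  move=> [e e0 H]; exists e => // h he; apply: H.
  by rewrite /= sub0r normrN.
pose phi (k : R) := f (k *: v + x).
pose psi (k : R) : R := 'D_v f (k *: v + x).
have dphi (h : R) : `|h| < e -> is_derive h 1 phi (psi h).
  move=> he; apply: DeriveDef; first by apply: derivable_line; apply: df; exact: He.
  by rewrite /psi derive_line.
have phi0 : phi 0 = f x by rewrite /phi scale0r add0r.
have psi0 : psi 0 = 0.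
  have d0 : is_derive (0 : R) 1 phi 0.
    apply: (@derive1_at_max _ _ (- e) e).
    - by rewrite ge0_cp ?ltW.
    - by move=> t; rewrite in_itv/= -ltr_norml => /dphi[].
    - by rewrite in_itv/= oppr_lt0 e0.
    - by move=> t; rewrite in_itv/= -ltr_norml => /He Ht; rewrite phi0; exact: fmax.
  have [_ <-] : is_derive (0 : R) 1 phi (psi 0) by apply: dphi; rewrite normr0.
  by have [_ ->] := d0.
rewrite leNgt; apply/negP => D0.
have cpsi : k^-1 * psi k @[k --> (0 : R)^'] --> 'D_v ('D_v f) x.
  have H : k^-1 *: (('D_v f \o shift x) (k *: v) - 'D_v f x) @[k --> (0 : R)^'] --> 'D_v ('D_v f) x by exact: ddf.
  have E : (fun k : R => k^-1 *: (('D_v f \o shift x) (k *: v) - 'D_v f x)) = fun k => k^-1 * psi k.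
    apply/funext => k /=; rewrite (_ : 'D_v f x = 0) ?subr0//.
    by rewrite -psi0 /psi scale0r add0r.
  by rewrite E in H.
have : \forall k \near (0 : R)^', 0 < k^-1 * psi k by apply: (cvgr_gt _ cpsi).
rewrite near_withinE => -[d /= d0 Hd].
pose k := Num.min d e / 2.
have k0 : 0 < k by rewrite divr_gt0// lt_min d0.
have kd : k < d by rewrite ltr_pdivrMr// (@le_lt_trans _ _ d) ?ge_min ?lexx// ltr_pMr// ltr1n.
have ke : k < e by rewrite ltr_pdivrMr// (@le_lt_trans _ _ e) ?ge_min ?lexx ?orbT// ltr_pMr// ltr1n.
have inke t : 0 <= t <= k -> `|t| < e.
  by move=> /andP[t0 tk]; rewrite ger0_norm//; exact: le_lt_trans ke.
have [||t tk E] := @MVT _ phi psi 0 k k0.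
- by move=> t; rewrite in_itv/= => /andP[t0 tk]; apply: dphi; apply: inke; rewrite !ltW.
- apply: derivable_within_continuous => t; rewrite in_itv/= => h.
  by have [] := dphi t (inke t h).
move: tk; rewrite in_itv/= => /andP[t0 tk].
have : 0 < t^-1 * psi t.
  by apply: Hd; [rewrite /= sub0r normrN gtr0_norm// (lt_trans tk)|rewrite gt_eqF].
rewrite pmulr_rgt0 ?invr_gt0// => psit.
have := fmax (k *: v + x) (He k _); rewrite gtr0_norm// => /(_ ke).
rewrite -phi0 -/(phi k) -subr_le0 E subr0 pmulr_lle0// leNgt.
by rewrite psit.
Qed.
End second_derivative.

(** * The Hadamard derivative at a maximum *)

Section hadamard_comparison.
Context {R : realType}.
Notation mu := (@lebesgue_measure R).
Implicit Types (f g : R -> R) (alpha T t : R).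

Lemma measurable_log_kernel alpha t : measurable_fun `]1, t[ (log_kernel alpha t).
Proof.
apply: open_continuous_measurable_fun => // s.
rewrite inE/= in_itv/= => /andP[s1 st].
apply: differentiable_continuous; apply/derivable1_diffP.
by have [] := is_derive_log_kernel alpha (lt_trans ltr01 s1) st.
Qed.

Lemma integrable_patch (A : set R) f : measurable A ->
  mu.-integrable A (EFin \o f) -> mu.-integrable setT (EFin \o (f \_ A)).
Proof. by move=> mA; rewrite integrable_mkcond// restrict_EFin. Qed.

(** The pointwise derivative may be replaced by a function [g] of which [f] is
    a primitive; [g] is cut off outside ]1, t[ so that it vanishes at [t],
    where the kernel is singular. *)
Lemma hadamardE alpha T t f : 1 < t <= T ->
  {within `[1, T], continuous f} -> W12 1 T f -> hadamard_converges alpha f t ->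
  exists g, [/\ mu.-integrable setT (EFin \o g),
    g t = 0,
    (forall x y, 1 <= x -> x <= y -> y <= t -> f y - f x = \int[mu]_(s in `[x, y]) g s),
    mu.-integrable `[1, t] (EFin \o (fun s => log_kernel alpha t s * g s)) &
    hadamard alpha f t =
      (Gamma (1 - alpha))^-1 * \int[mu]_(s in `[1, t]) (log_kernel alpha t s * g s)].
Proof.
move=> /andP[t1 tT] cf Wf hc; have T1 : 1 < T by exact: lt_le_trans tT.
have [g0 [ig0 fg0 ae0]] := W12_FTC T1 cf Wf.
pose k := log_kernel alpha t.
pose g := g0 \_ `]1, t[.
have mg0 D : measurable D -> measurable_fun D g0.
  by move=> mD; apply/measurable_EFinP; apply: measurable_funTS; exact: measurable_int ig0.
have mk : measurable_fun `]1, t[ k by exact: measurable_log_kernel.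
have mkg0 : measurable_fun `]1, t[ (EFin \o (fun s => k s * g0 s)).
  by apply/measurable_EFinP; apply: measurable_funM; [|exact: mg0].
have ae1 : ae_eq mu `]1, t[%classic (EFin \o hadamard_integrand alpha f t) (EFin \o (fun s => k s * g0 s)).
  move: ae0; apply: filterS; first exact: (ae_filter_ringOfSetsType mu).
  move=> s /= H; rewrite in_itv/= => /andP[s1 st]; congr (_%:E).
  by rewrite /hadamard_integrand H// s1 (lt_le_trans st).
have ikg0 : mu.-integrable `]1, t[ (EFin \o (fun s => k s * g0 s)).
  have /integrableP[mh hfin] := hc; apply/integrableP; split => //.
  rewrite -(@ge0_ae_eq_integral _ _ _ mu _ (abse \o (EFin \o hadamard_integrand alpha f t)))//.
  - exact: measurableT_comp.
  - exact: measurableT_comp.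
  - by move=> s _; exact: abse_ge0.
  - move: ae0; apply: filterS; first exact: (ae_filter_ringOfSetsType mu).
    move=> s /= H; rewrite in_itv/= => /andP[s1 st].
    by rewrite /hadamard_integrand H// s1 (lt_le_trans st).
have kgE : (fun s => k s * g s) = (fun s => k s * g0 s) \_ `]1, t[.
  by apply/funext => s; rewrite /g !patchE; case: ifP => // _; rewrite mulr0.
have sub : `]1, t[%classic `<=` `[1, t]%classic by exact: subset_itv_oo_cc.
have ig : mu.-integrable setT (EFin \o g).
  by apply: integrable_patch => //; exact: integrableS ig0.
exists g; split => //.
- by rewrite /g patchE ifF//; apply/negbTE; rewrite notin_setE/= in_itv/= ltxx andbF.
- move=> x y x1 xy yt; rewrite fg0//; last exact: le_trans tT.
  have igS D : measurable D -> mu.-integrable D (EFin \o g) by move=> mD; exact: integrableS ig.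
  have ig0S D : measurable D -> mu.-integrable D (EFin \o g0) by move=> mD; exact: integrableS ig0.
  rewrite -(@Rintegral_itv_obnd_cbnd _ x); last exact: ig0S.
  rewrite -(@Rintegral_itv_bndo_bndc _ _ y); last exact: ig0S.
  rewrite -[RHS](@Rintegral_itv_obnd_cbnd _ x); last exact: igS.
  rewrite -[RHS](@Rintegral_itv_bndo_bndc _ _ y); last exact: igS.
  apply: eq_Rintegral => s; rewrite inE/= in_itv/= => /andP[xs sy].
  by rewrite /g patchE mem_set//= in_itv/= (le_lt_trans x1 xs) (lt_le_trans sy yt).
- by rewrite kgE; apply: (@integrableS _ _ _ mu setT) => //; exact: integrable_patch.
- rewrite /hadamard; congr (_ * _); rewrite kgE.
  rewrite [RHS](Rintegral_subset sub); last first.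
    by move=> s _ hs; rewrite ifF//; apply/negbTE; rewrite notin_setE.
  transitivity (\int[mu]_(s in `]1, t[) (k s * g0 s)); last first.
    by apply: eq_Rintegral => s ->.
  congr fine; apply: ae_eq_integral => //.
  by have /integrableP[] := hc.
Qed.

(** The extremum inequality, applied to f1 - f2, whose increments are the
    integrals of the difference of the two densities given by [hadamardE].
    The densities can be subtracted everywhere, the functions [derive1 f1] and
    [derive1 f2] only where both derivatives exist. *)
Lemma hadamard_sub_gt0 alpha T t f1 f2 : 0 < alpha < 1 -> 1 < t <= T ->
  {within `[1, T], continuous f1} -> W12 1 T f1 -> hadamard_converges alpha f1 t ->
  {within `[1, T], continuous f2} -> W12 1 T f2 -> hadamard_converges alpha f2 t ->
  (forall s, 1 <= s <= t -> f1 s - f2 s <= f1 t - f2 t) ->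
  f1 1 - f2 1 < f1 t - f2 t ->
  hadamard alpha f2 t < hadamard alpha f1 t.
Proof.
move=> /andP[a0 a1] t1T c1 W1 h1 c2 W2 h2 fmax f1t.
have /andP[t1 tT] := t1T.
have [g1 [ig1 g1t fg1 ikg1 ->]] := hadamardE t1T c1 W1 h1.
have [g2 [ig2 g2t fg2 ikg2 ->]] := hadamardE t1T c2 W2 h2.
have G0 : 0 < Gamma (1 - alpha) by apply: Gamma_gt0; lra.
rewrite ltr_pM2l ?invr_gt0// -subr_gt0 -RintegralB//.
pose w s := f1 s - f2 s; pose g s := g1 s - g2 s.
pose k := log_kernel alpha t.
have kgE : (fun s => k s * g1 s - k s * g2 s) = (fun s => k s * g s).
  by apply/funext => s; rewrite /g mulrBr.
rewrite kgE.
have K : k 1 * (w t - w 1) <= \int[mu]_(s in `[1, t]) (k s * g s).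
  apply: (@monotone_kernel_ge _ 1 t k w g) => //.
  - by move=> s _; exact: powR_ge0.
  - by move=> x y; exact: log_kernel_nondecreasing.
  - by move=> r; exact: log_kernel_lipschitz.
  - apply: (@integrableS _ _ _ mu setT) => //; exact: (integrableB _ ig1 ig2).
  - rewrite -kgE; exact: (integrableB _ ikg1 ikg2).
  - by rewrite /g g1t g2t subrr.
  - move=> x y x1 xy yt; rewrite RintegralB//; last 2 first.
    + exact: integrableS ig1.
    + exact: integrableS ig2.
    by rewrite -fg1// -fg2// /w; ring.
apply: lt_le_trans K; rewrite mulr_gt0//; last by rewrite subr_gt0.
by rewrite /k powR_gt0// ln_ratio_gt0.
Qed.
End hadamard_comparison.

(** * The maximum principle *)

Section maximum_principle.
Context {R : realType} {n : nat}.
Implicit Types (G : set 'rV[R]_n) (f : 'rV[R]_n -> R).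

Lemma bounded_closure G : bounded_set G -> bounded_set (closure G).
Proof.
move=> [M [_ HM]]; exists (M + 1); split; first exact: num_real.
move=> c Mc; rewrite closureE => x; apply; split; last first.
  by apply: HM; rewrite (lt_trans _ Mc)// ltrDl.
apply: (@closed_comp _ _ (fun y : 'rV[R]_n => `|y|) [set r : R | r <= c]).
  by move=> y _; exact: norm_continuous.
exact: closed_le.
Qed.

Lemma second_derive_sub_le0 G f1 f2 x (v : 'rV[R]_n) : open G -> G x ->
  (forall y, G y -> derivable f1 y v) -> (forall y, G y -> derivable f2 y v) ->
  derivable ('D_v f1) x v -> derivable ('D_v f2) x v ->
  (forall y, G y -> f1 y - f2 y <= f1 x - f2 x) ->
  'D_v ('D_v f1) x <= 'D_v ('D_v f2) x.
Proof.
move=> oG Gx d1 d2 dd1 dd2 fmax.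
have nE : \forall y \near x, ('D_v f1 - 'D_v f2) y = 'D_v (f1 - f2) y.
  have : \forall y \near x, G y by exact: open_nbhs_nbhs.
  apply: filterS => y Gy; apply/esym; exact: (deriveB (d1 y Gy) (d2 y Gy)).
have dd := near_eq_derivable nE (derivableB dd1 dd2).
have d y : G y -> derivable (f1 - f2) y v by move=> Gy; exact: derivableB (d1 y Gy) (d2 y Gy).
have := second_derive_le0_max oG Gx d dd fmax.
by rewrite -(near_eq_derive v nE) (deriveB dd1 dd2) subr_le0.
Qed.

Lemma laplacian_sub_le0 G (f1 f2 : 'rV[R]_n -> R) x : open G -> G x ->
  Ck_on 2 G f1 -> Ck_on 2 G f2 ->
  (forall y, G y -> f1 y - f2 y <= f1 x - f2 x) ->
  laplacian f1 x <= laplacian f2 x.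
Proof.
move=> oG Gx [df1 _] [df2 _] fmax; apply: ler_sum => j _.
apply: (second_derive_sub_le0 oG Gx) => //.
- exact: (df1 [::] j isT).
- exact: (df2 [::] j isT).
- exact: (df1 [:: j] j isT x Gx).
- exact: (df2 [:: j] j isT x Gx).
Qed.

Lemma continuous_section (T : R) G (v : 'rV[R]_n -> R -> R) x : G x ->
  {within closure G `*` `[1, T]%classic, continuous (fun z => v z.1 z.2)} ->
  {within `[1, T], continuous (v x)}.
Proof.
move=> Gx /subspace_continuousP cv; apply/subspace_continuousP => t tT.
have cGx : closure G x by exact: subset_closure.
have c : (fun s : R => (x, s)) @ t --> (x, t) by exact: (cvg_pair (cvg_cst x) (@cvg_id _ (nbhs t))).
move=> B /(cv (x, t) (conj cGx tT)) /c Bt.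
have {}Bt : \forall s \near t, (closure G `*` `[1, T]%classic) (x, s) -> B (v x s) by exact: Bt.
suff : \forall s \near t, `[1, T]%classic s -> B (v x s) by [].
by apply: filterS Bt => s H sT; apply: H; split.
Qed.

(** The source term cancels in the difference of the two equations; at a maximum
    above [delta] the two sides of what remains would have opposite signs. *)
Lemma classical_solution_le (alpha nu T delta : R) G (F u1 u2 : 'rV[R]_n -> R -> R) :
  0 < alpha < 1 -> 0 < nu -> bounded_domain G ->
  classical_solution alpha nu T G F u1 ->
  classical_solution alpha nu T G F u2 ->
  (forall x t, boundary G x -> 1 <= t <= T -> u1 x t - u2 x t <= delta) ->
  (forall x, closure G x -> u1 x 1 - u2 x 1 <= delta) ->
  forall x t, closure G x -> 1 <= t <= T -> u1 x t - u2 x t <= delta.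
Proof.
move=> a01 nu0 [oG _ _ bG] [c1 C1 W1 h1 e1] [c2 C2 W2 h2 e2] bd init x t Gx tT.
rewrite leNgt; apply/negP => wxt.
pose w (z : 'rV[R]_n * R) := u1 z.1 z.2 - u2 z.1 z.2.
pose K := closure G `*` `[1, T]%classic.
have cK : compact K.
  apply: compact_setX; last exact: segment_compact.
  by apply: bounded_closed_compact; [exact: bounded_closure|exact: closed_closure].
have cw : {within K, continuous w}.
  by move=> z; apply: cvgB; [exact: c1|exact: c2].
have [|[x0 t0] /set_mem[/= Gx0] + wmax] := @compact_EVT_max _ _ w K _ cK cw.
  by exists (x, t); split.
rewrite in_itv/= => t0T.
have w0 : delta < u1 x0 t0 - u2 x0 t0.
  apply: lt_le_trans wxt _; apply: (wmax (x, t)); rewrite inE; by split.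
have Gx0' : G x0.
  apply: contrapT => nGx0; have := w0; rewrite ltNge bd//.
  by split => // /interior_subset.
have t01 : 1 < t0.
  have /andP[] := t0T; rewrite le_eqVlt => /predU1P[t0E|//] _.
  by have := w0; rewrite ltNge -t0E init.
have t01T : 1 < t0 <= T by rewrite t01; case/andP : t0T.
have hlt : hadamard alpha (u2 x0) t0 < hadamard alpha (u1 x0) t0.
  apply: (hadamard_sub_gt0 a01 t01T).
  - exact: continuous_section c1.
  - exact: W1.
  - exact: h1.
  - exact: continuous_section c2.
  - exact: W2.
  - exact: h2.
  - move=> s /andP[s1 st]; apply: (wmax (x0, s)); rewrite inE; split => //=.
    by rewrite in_itv/= s1 (le_trans st)//; case/andP : t01T.
  - by apply: le_lt_trans w0; apply: init.
have lap : laplacian (fun y => u1 y t0) x0 <= laplacian (fun y => u2 y t0) x0.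
  apply: (laplacian_sub_le0 oG Gx0' (C1 _ t01T) (C2 _ t01T)) => y Gy.
  apply: (wmax (y, t0)); rewrite inE; split => //=.
  exact: subset_closure.
move: hlt; rewrite e1// e2// ltrD2r ltr_pM2l// ltNge.
by rewrite lap.
Qed.
End maximum_principle.

Theorem theorem4p6 (R : realType) (n : nat) (alpha nu T delta : R)
    (G : set 'rV[R]_n) (F u ubar : 'rV[R]_n -> R -> R)
    (phi phibar : 'rV[R]_n -> R)
    (n_gt0 : (0 < n)%N)
    (alpha_itv : 0 < alpha < 1) (nu_gt0 : 0 < nu) (T_gt1 : 1 < T)
    (G_domain : bounded_domain G) (G_smooth : smooth_boundary G)
    (F_cont :
      {within closure G `*` `[1, T]%classic, continuous (fun z => F z.1 z.2)})
    (phi_cont : {within closure G, continuous phi})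
    (phibar_cont : {within closure G, continuous phibar})
    (u_sol : classical_solution alpha nu T G F u)
    (ubar_sol : classical_solution alpha nu T G F ubar)
    (u_bdry : forall x t, boundary G x -> 1 <= t <= T -> u x t = 0)
    (ubar_bdry : forall x t, boundary G x -> 1 <= t <= T -> ubar x t = 0)
    (u_init : forall x, closure G x -> u x 1 = phi x)
    (ubar_init : forall x, closure G x -> ubar x 1 = phibar x)
    (phi_close : forall x, closure G x -> `|phi x - phibar x| <= delta) :
  forall x t, closure G x -> 1 <= t <= T -> `|u x t - ubar x t| <= delta.
Proof.
move=> x t Gx tT.
have delta0 : 0 <= delta by exact: le_trans (normr_ge0 _) (phi_close x Gx).
rewrite ler_norml lerNl opprB; apply/andP; split.
- apply: (classical_solution_le alpha_itv nu_gt0 G_domain ubar_sol u_sol) => //.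
  + by move=> y s yG sT; rewrite u_bdry// ubar_bdry// subrr.
  + move=> y Gy; rewrite u_init// ubar_init//.
    by rewrite (le_trans (ler_norm _))// distrC phi_close.
- apply: (classical_solution_le alpha_itv nu_gt0 G_domain u_sol ubar_sol) => //.
  + by move=> y s yG sT; rewrite u_bdry// ubar_bdry// subrr.
  + move=> y Gy; rewrite u_init// ubar_init//.
    by rewrite (le_trans (ler_norm _))// phi_close.
Qed.
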